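(* Let $N\ge 1$ be an integer and let $\theta\in\mathbb{C}$ be any primitive $N$-th root of $1$. Let $S_{KNW}$ denote the space of functions $f\in C(\mathbb{C},\mathbb{C})$ which satisfy $$\frac{1}{N}\sum_{k=0}^{N-1}f(x+\theta^ky)=f(x)\quad\text{for all } x,y\in\mathbb{C}.$$ Then $$S_{KNW}=\{a_0+a_1z+\cdots +a_{N-1}z^{N-1}+b_1\overline{z}+\cdots+b_{N-1}\overline{z}^{N-1}:(a_0,\cdots,a_{N-1},b_1,\cdots,b_{N-1})\in\mathbb{C}^{2N-1}\}.$$
   Context: $C(\mathbb{C},\mathbb{C})$ denotes the space of continuous functions $f:\mathbb{C}\to\mathbb{C}$, and $\overline{z}$ is the complex conjugate of $z$; the elements of the set on the right are viewed as functions of $z\in\mathbb{C}$. The functional equation in the statement is called the Kakutani-Nagumo-Walsh equation. *)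

(* Defs.v *)
From HB Require Import structures.
From mathcomp Require Import all_boot all_order all_algebra.
From mathcomp Require Import all_classical all_reals all_analysis.
From mathcomp Require Import complex.

Set Implicit Arguments.
Unset Strict Implicit.
Unset Printing Implicit Defensive.

Import Order.TTheory GRing.Theory Num.Theory.
Import numFieldNormedType.Exports.

Local Open Scope classical_set_scope.
Local Open Scope ring_scope.
Local Open Scope complex_scope.

(* The type [R[i]] carries no topology by itself; its alias [R[i]^o] carries
   the one induced by the modulus. *)
Definition S_KNW (R : realType) (N : nat) (theta : R[i]) :
    set (R[i] -> R[i]) :=
  [set f : R[i] -> R[i] |
           continuous (f : R[i]^o -> R[i]^o) /\
           forall x y : R[i],
             N%:R^-1 * (\sum_(k < N) f (x + theta ^+ k * y)) = f x].

(* The coefficients are a_k = [a 0 k] for 0 <= k <= N - 1, and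
   b_k = [b 0 (k - 1)] for 1 <= k <= N - 1. *)
Definition poly_z_zbar (R : realType) (N : nat)
    (a : 'rV[R[i]]_N) (b : 'rV[R[i]]_N.-1) : R[i] -> R[i] :=
  fun z => (\sum_(k < N) a 0 k * z ^+ k) +
           (\sum_(k < N.-1) b 0 k * (z ^*) ^+ k.+1).

(* Main.v *)
Require Import Defs.
From HB Require Import structures.
From mathcomp Require Import all_boot all_order all_algebra.
From mathcomp Require Import all_classical all_reals all_analysis.
From mathcomp Require Import complex.
From mathcomp Require Import ring zify.

Set Implicit Arguments.
Unset Strict Implicit.
Unset Printing Implicit Defensive.

Import Order.TTheory GRing.Theory Num.Theory.
Import numFieldNormedType.Exports.

Local Open Scope classical_set_scope.
Local Open Scope ring_scope.

(** Let W be the space of all functions, continuous or not, that satisfy the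
    functional equation. It is a vector space, and the equation is insensitive
    to translations [z |-> z + v] and to complex dilations [z |-> c * z], so W
    is stable under both. The proof plays these symmetries against each other.

    First, a function f of W is a generalized polynomial. The equation writes
    f(x) as a sum of N functions of [x + theta^k y]; moving x and y together so
    that one of the points [x + theta^k y] stays fixed, and subtracting, removes
    that summand at the cost of one finite difference of f. After N steps the
    N-fold difference of f in any direction vanishes ([iter_fdiff_eq0]).

    Second, if f is continuous then it is an honest polynomial in the real and
    imaginary parts. Newton's forward formula expands f along any arithmetic
    progression, with coefficients the iterated differences of f and basis the
    binomial polynomials. A progression shares infinitely many points with
    each of its refinements, so their polynomials agree, and the expansion holds
    at rational and then, by continuity, at real times ([newton_poly_real]).
    The coefficients are iterated differences of f, which lie again in W, so
    the expansion in the horizontal direction can be followed by one in the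
    vertical direction. Hence f is a finite sum of terms
    [c a b * z ^+ a * z^* ^+ b] ([knw_zzbar_poly]).

    Third, the monomials [z ^+ a * z^* ^+ b] are eigenvectors of every
    dilation, and one dilation can be chosen that gives distinct eigenvalues to
    the finitely many monomials at hand. A stable subspace that contains a sum
    of such eigenvectors contains each of them, so every monomial that occurs
    in f is itself in W ([knw_monomial_summand]). Translating by 1 then shows
    that W contains every monomial dividing one of its members
    ([knw_monomial_le]). Finally W does not contain [z * z^*], [z ^+ N] or
    [z^* ^+ N]: these take the value 1 at every power of theta, so their
    average over the powers of theta is 1, while they vanish at 0, the centre of
    that polygon. What remains are the powers of z and of its conjugate of
    exponent less than N ([knw_monomialP]).

    Conversely, in the binomial expansion of [(x + theta^k y)^m] with m < N the
    sum over k cancels all terms except [x^m]. *)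

(** * Finite differences and Newton interpolation *)

Definition fdiff (C : zmodType) (v : C) (f : C -> C) : C -> C :=
  fun x => f (x + v) - f x.

(** Each entry [(al, g)] of [s] stands for a summand [g (x + al * y)]. Allowing
    a different function in every summand is what makes the induction go
    through: one step replaces f and all the remaining g by differences. *)
Lemma iter_fdiff_eq0 (C : fieldType) (v : C) (s : seq (C * (C -> C)))
    (f : C -> C) :
  all (fun p => p.1 != 0) s ->
  (forall x y, f x = \sum_(p <- s) p.2 (x + p.1 * y)) ->
  forall x, iter (size s) (fdiff v) f x = 0.
Proof.
have [n] := ubnP (size s); elim: n => // n IHn in s f *.
case: s => [|[al g] s] /=; first by move=> _ _ fE x; rewrite (fE x 0) big_nil.
rewrite ltnS => les /andP[al0 s0] fE x; rewrite -iterS iterSr.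
pose s' := [seq (p.1, fdiff ((1 - p.1 / al) * v) p.2) | p <- s].
have -> : size s = size s' by rewrite size_map.
apply: IHn; first by rewrite size_map.
  by rewrite all_map; apply: sub_all s0.
(* Shifting x by v and y by - v / al leaves x + al * y unchanged. *)
move=> {}x y; rewrite /fdiff (fE _ (y - v / al)) (fE x y) !big_cons /=.
have -> : x + v + al * (y - v / al) = x + al * y by field.
rewrite big_map opprD addrACA subrr add0r -sumrB /=.
by apply: eq_bigr => p _; congr (p.2 _ - _); field.
Qed.

(** Newton's forward difference formula; the sum stops at n independently of k
    because the differences of order n vanish. *)
Lemma newton_forward (C : pzRingType) (v : C) (n : nat) (f : C -> C) :
  (forall x, iter n (fdiff v) f x = 0) ->
  forall k x, f (x + v *+ k) =
    \sum_(j < n) 'C(k, j)%:R * iter j (fdiff v) f x.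
Proof.
case: n => [|n] Df0.
  by move=> k x; rewrite big_ord0; apply: (Df0 _).
elim=> [|k IHk] x.
  rewrite mulr0n addr0 big_ord_recl /= mul1r big1 ?addr0// => j _.
  by rewrite mul0r.
have Dfx j : iter j (fdiff v) f (x + v) =
    iter j (fdiff v) f x + iter j.+1 (fdiff v) f x.
  by rewrite iterS {3}/fdiff [RHS]addrC subrK.
rewrite mulrS addrA IHk.
under eq_bigr do rewrite Dfx mulrDr.
rewrite big_split /= big_ord_recl [X in _ + X]big_ord_recr /=.
rewrite -iterS Df0 mulr0 addr0 -addrA -big_split /= [RHS]big_ord_recl /=.
rewrite !bin0; congr (_ + _); apply: eq_bigr => j _.
by rewrite /bump /= add1n binS natrD mulrDl.
Qed.

Definition binomial_poly (C : fieldType) (j : nat) : {poly C} :=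
  (j`!%:R^-1) *: \prod_(i < j) ('X - i%:R%:P).

Lemma horner_binomial_poly (C : numFieldType) (j k : nat) :
  (binomial_poly C j).[k%:R] = 'C(k, j)%:R.
Proof.
have j0 : j`!%:R != 0 :> C by rewrite pnatr_eq0 -lt0n fact_gt0.
apply: (mulIf j0); rewrite -natrM bin_ffact hornerZ mulrAC mulVf// mul1r.
rewrite horner_prod {j0}; elim: j => [|j IHj]; first by rewrite big_ord0.
rewrite big_ord_recr /= IHj hornerXsubC ffactnSr natrM.
have [lejk|ltkj] := leqP j k; first by rewrite natrB.
by rewrite ffact_small// !mul0r.
Qed.

Definition newton_poly (C : fieldType) (n : nat) (f : C -> C) (v x : C) :=
  \sum_(j < n) (iter j (fdiff v) f x) *: binomial_poly C j.

Lemma horner_newton_poly (C : numFieldType) (n : nat) (f : C -> C) (v x : C) :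
  (forall x, iter n (fdiff v) f x = 0) ->
  forall k, (newton_poly n f v x).[k%:R] = f (x + k%:R * v).
Proof.
move=> Df0 k; rewrite mulr_natl (newton_forward Df0) horner_sum.
by apply: eq_bigr => j _; rewrite hornerZ horner_binomial_poly mulrC.
Qed.

(** In characteristic 0 the natural numbers are infinitely many points. *)
Lemma poly_natr_inj (C : numFieldType) (p q : {poly C}) :
  (forall k : nat, p.[k%:R] = q.[k%:R]) -> p = q.
Proof.
move=> epq; apply/eqP; rewrite -subr_eq0; apply/negP => /negP pq0.
pose rs := mkseq (fun k => k%:R : C) (size (p - q)).
suff: (size rs < size (p - q)%R)%N by rewrite size_mkseq ltnn.
apply: max_poly_roots => //.
  by apply/allP => _ /mapP[k _ ->]; rewrite rootE hornerD hornerN epq subrr.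
by apply/mkseq_uniqP => i j _ _ /eqP; rewrite eqr_nat => /eqP.
Qed.

(** The interpolation with step [v / m] that starts at [x - K * v] meets all the
    points [x + j * v], so it is the same polynomial as the one with step v up
    to an affine change of variable, and it also takes the right values at the
    intermediate points. Starting K steps back is what reaches negative
    times. *)
Lemma newton_poly_rat (C : numFieldType) (n : nat) (f : C -> C) (v x : C)
    (k K m : nat) :
  (forall v x, iter n (fdiff v) f x = 0) -> (0 < m)%N ->
  (newton_poly n f v x).[k%:R / m%:R - K%:R] =
    f (x + (k%:R / m%:R - K%:R) * v).
Proof.
move=> Df0 m_gt0; have m0 : m%:R != 0 :> C by rewrite pnatr_eq0 -lt0n.
pose q := newton_poly n f (v / m%:R) (x - K%:R * v).
have qE j : q.[j%:R] = f (x + (j%:R / m%:R - K%:R) * v).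
  by rewrite horner_newton_poly//; congr f; field.
have -> : newton_poly n f v x = q \Po (m%:R *: ('X + K%:R%:P)).
  apply: poly_natr_inj => j.
  rewrite horner_comp hornerZ hornerD hornerX hornerC -natrD -natrM qE.
  by rewrite horner_newton_poly//; congr f; rewrite natrM natrD; field.
rewrite horner_comp hornerZ hornerD hornerX hornerC -qE.
by congr horner; field.
Qed.

(** * Eigenvectors of dilations *)

Definition dilation_subspace (C : pzRingType) (W : set (C -> C)) : Prop :=
  (forall c f g, W f -> W g -> W (fun z => f z + c * g z)) /\
  (forall c f, W f -> W (fun z => f (c * z))).

Lemma dilation_subspaceZ (C : fieldType) (W : set (C -> C)) (f : C -> C) c :
  dilation_subspace W -> c != 0 -> W (fun z => c * f z) -> W f.
Proof.
move=> [WD _] c0 Wcf.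
have -> : f = (fun z => c * f z + (c^-1 - 1) * (c * f z)).
  by apply/funext => z; field.
exact: WD.
Qed.

(** Applying [dilation - chi i] to the sum kills the i-th summand and multiplies
    the others by non-zero scalars, which allows an induction on the number of
    summands. *)
Lemma eigenfunction_summand (C : fieldType) (W : set (C -> C)) (I : eqType)
    (lam : C) (chi : I -> C) (s : seq I) (g : I -> C -> C) :
  dilation_subspace W -> uniq (map chi s) ->
  (forall i z, g i (lam * z) = chi i * g i z) ->
  W (fun z => \sum_(i <- s) g i z) -> {in s, forall i, W (g i)}.
Proof.
move=> Wsub; have [WD Wdil] := Wsub.
elim: s g => // i s IHs g /= /andP[chi_i s_uniq] gE Wg.
have Wgs j : j \in s -> W (g j).
  move=> js; apply: (@dilation_subspaceZ _ _ _ (chi j - chi i)) => //.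
    by rewrite subr_eq0; apply: contraNneq chi_i => <-; apply: map_f.
  apply: (IHs (fun j z => (chi j - chi i) * g j z)) js => // [j' z|].
    by rewrite gE; ring.
  have := WD (- chi i) _ _ (Wdil lam _ Wg) Wg.
  congr W; apply/funext => z; rewrite !big_cons gE.
  rewrite mulrDr addrACA mulNr subrr add0r big_distrr -big_split /=.
  by apply: eq_bigr => j' _; rewrite gE; ring.
move=> j; rewrite inE => /predU1P[->|]; last exact: Wgs.
(* The i-th summand is the total minus the summands already known to be in W. *)
have WB (r : seq I) f : {subset r <= s} -> W f ->
    W (fun z => f z - \sum_(k <- r) g k z).
  elim: r f => [|k r IHr] f rs Wf.
    by congr W : Wf; apply/funext => z; rewrite big_nil subr0.
  have ks : k \in s by rewrite rs ?mem_head.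
  have rs' : {subset r <= s} by move=> k' k'r; rewrite rs// inE k'r orbT.
  have := IHr _ rs' (WD (-1) _ _ Wf (Wgs _ ks)).
  by congr W; apply/funext => z; rewrite big_cons; ring.
have := WB s _ (fun _ => id) Wg.
by congr W; apply/funext => z; rewrite big_cons addrK.
Qed.

(** * Monomials in z and its conjugate *)

Definition monomial (C : numClosedFieldType) (a b : nat) : C -> C :=
  fun z => z ^+ a * (z^*) ^+ b.

(** An element whose [2 ^ e]-th power is -1 has an
    order that divides [2 ^ e.+1] but not [2 ^ e], and for powers of a prime this
    determines the order. *)
Lemma primitive_root_2exp (C : numClosedFieldType) (e : nat) :
  {zeta : C | (2 ^ e.+1)%N.-primitive_root zeta}.
Proof.
pose z : C := (2 ^ e)%N.-root (-1); exists z.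
have zN1 : z ^+ (2 ^ e)%N = -1 by rewrite rootCK// expn_gt0.
have z1 : z ^+ (2 ^ e.+1)%N = 1 by rewrite expnSr exprM zN1 sqrrN expr1n.
have [|m m_prim m_dvd] := prim_order_exists _ z1; first by rewrite expn_gt0.
have /(dvdn_pfactor _ _ (isT : prime 2))[k lek mE] := m_dvd.
suff <- : k = e.+1 by rewrite -mE.
apply/eqP; rewrite eqn_leq lek leqNgt ltnS; apply/negP => leke.
have := prim_expr_order m_prim.
move: (dvdn_exp2l 2 leke); rewrite -mE => /dvdnP[c ec] zm1.
move: zN1; rewrite ec mulnC exprM zm1 expr1n => /eqP.
by rewrite -addr_eq0 -mulr2n pnatr_eq0.
Qed.

Lemma monomial_dilation (C : numClosedFieldType) (a b : nat) (lam z : C) :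
  monomial a b (lam * z) = monomial a b lam * monomial a b z.
Proof. by rewrite /monomial rmorphM !exprMn mulrACA. Qed.

Lemma norm_primitive_root (C : numClosedFieldType) (n : nat) (z : C) :
  n.-primitive_root z -> `|z| = 1.
Proof.
move=> z_prim; have /(congr1 Num.norm) := prim_expr_order z_prim.
move/eqP; rewrite normrX normr1 pexprn_eq1// => /orP[/eqP n0|/eqP//].
by have := prim_order_gt0 z_prim; rewrite n0.
Qed.

(** At [2 * z] with z a root of unity, the modulus of the monomial is
    [2 ^ (a + b)] and its phase is [z ^ (a - b)]. When z has order at least 2D
    these determine [a + b] and [a - b]. *)
Lemma monomial_separating_point (C : numClosedFieldType) (D : nat) :
  {lam : C | injective (fun p : 'I_D * 'I_D => monomial p.1 p.2 lam)}.
Proof.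
have [z z_prim] := primitive_root_2exp C D.
have zn : `|z| = 1 by apply: norm_primitive_root z_prim.
have zz : z * z^* = 1 by rewrite -normCK zn expr1n.
exists (2 * z) => -[a b] [a' b'] /= eqm.
have eqs : (a + b = a' + b')%N.
  have /(congr1 Num.norm) := eqm.
  rewrite /monomial !normrM !normrX norm_conjC normrM zn normr_nat !mulr1 -!exprD.
  by move/eqP; rewrite -!natrX eqr_nat eqn_exp2l// => /eqP.
move: eqm; rewrite !monomial_dilation.
have -> : monomial a b (2 : C) = monomial a' b' 2.
  by rewrite /monomial conjC_nat -!exprD eqs.
have m20 : monomial a' b' (2 : C) != 0.
  by rewrite /monomial conjC_nat -exprD expf_eq0 pnatr_eq0 andbF.
move/(mulfI m20).
(* Multiplying by z ^ (b + b') avoids negative exponents of z. *)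
have zb (i j : nat) : z ^+ j * monomial i j z = z ^+ i.
  by rewrite /monomial mulrCA -exprMn zz expr1n mulr1.
move/(congr1 (fun c => z ^+ (b + b') * c)).
rewrite {1}addnC !exprD -!mulrA !zb -!exprD => /eqP.
rewrite (eq_prim_root_expr z_prim).
have small (i j : 'I_D) : (i + j < 2 ^ D.+1)%N.
  rewrite expnS mul2n -addnn; have := ltn_expl D (isT : 1 < 2)%N.
  by have := ltn_ord i; have := ltn_ord j; lia.
rewrite !modn_small// => /eqP eqab.
by congr pair; apply/val_inj => /=; lia.
Qed.

(** * The Kakutani-Nagumo-Walsh equation *)

(** Clearing the denominator N keeps the equation meaningful over any field.
    Continuity is left out because the monomials are extracted by linear algebra
    alone. *)
Definition knw (C : fieldType) (N : nat) (theta : C) : set (C -> C) :=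
  [set f | forall x y, \sum_(k < N) f (x + theta ^+ k * y) = N%:R * f x].

Lemma knw_dilation_subspace (C : fieldType) (N : nat) (theta : C) :
  dilation_subspace (knw N theta).
Proof.
split=> [c f g Wf Wg x y|c f Wf x y].
  by rewrite big_split -big_distrr /= Wf Wg mulrDr mulrCA.
by rewrite -(Wf _ (c * y)); apply: eq_bigr => k _; congr f; ring.
Qed.

Lemma knw_translation (C : fieldType) (N : nat) (theta : C) f v :
  knw N theta f -> knw N theta (fun z => f (z + v)).
Proof.
by move=> Wf x y; rewrite -(Wf _ y); apply: eq_bigr => k _; congr f; ring.
Qed.

Lemma knw_fdiff (C : fieldType) (N : nat) (theta : C) f v :
  knw N theta f -> knw N theta (fdiff v f).
Proof.
move=> Wf; have [WD _] := knw_dilation_subspace N theta.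
have := WD (-1) _ _ (knw_translation v Wf) Wf.
by congr knw; apply/funext => z; rewrite /fdiff mulN1r.
Qed.

(** All N summands of the mean are the function f divided by N, taken at the
    dilation factors [theta ^+ k]. *)
Lemma knw_iter_fdiff_eq0 (C : numFieldType) (N : nat) (theta : C) f :
  (0 < N)%N -> theta != 0 -> knw N theta f ->
  forall v x, iter N (fdiff v) f x = 0.
Proof.
move=> N0 theta0 Wf v x.
pose s := [seq (theta ^+ k, fun z => N%:R^-1 * f z) | k : 'I_N <- index_enum 'I_N].
have <- : size s = N by rewrite size_map /index_enum -enumT size_enum_ord.
apply: iter_fdiff_eq0 => [|{}x y].
  by rewrite all_map; apply/allP => k _ /=; rewrite expf_neq0.
by rewrite big_map -big_distrr /= Wf mulKf// pnatr_eq0 -lt0n.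
Qed.

Lemma primitive_root_neq0 (C : fieldType) (N : nat) (theta : C) :
  N.-primitive_root theta -> theta != 0.
Proof. by move=> tp; rewrite (prim_root_eq0 tp) -lt0n (prim_order_gt0 tp). Qed.

Lemma knw_monomial_summand (C : numClosedFieldType) (N : nat) (theta : C)
    (D : nat) (c : nat -> nat -> C) :
  knw N theta (fun z => \sum_(a < D) \sum_(b < D) c a b * monomial a b z) ->
  forall a b, (a < D)%N -> (b < D)%N -> c a b != 0 ->
  knw N theta (monomial a b).
Proof.
move=> Wf a b aD bD cab; have [lam lamI] := monomial_separating_point C D.
have Wsub := knw_dilation_subspace N theta.
apply: (dilation_subspaceZ Wsub cab).
pose g (p : 'I_D * 'I_D) z := c p.1 p.2 * monomial p.1 p.2 z.
have Wg : knw N theta (fun z => \sum_(p <- index_enum ('I_D * 'I_D)%type) g p z).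
  by move: Wf; congr knw; apply/funext => z; rewrite pair_bigA.
have chi_uniq := etrans (map_inj_uniq lamI _) (index_enum_uniq ('I_D * 'I_D)%type).
have gE p z : g p (lam * z) = monomial p.1 p.2 lam * g p z.
  by rewrite /g monomial_dilation mulrCA.
have := eigenfunction_summand Wsub chi_uniq gE Wg.
exact: (fun H => H (Ordinal aD, Ordinal bD) (mem_index_enum _)).
Qed.

(** [(z + 1) ^ a * (z^* + 1) ^ b] contains every smaller monomial with a
    non-zero coefficient, and it is a translate of a member of the space. *)
Lemma knw_monomial_le (C : numClosedFieldType) (N : nat) (theta : C)
    (a b a' b' : nat) :
  (a' <= a)%N -> (b' <= b)%N -> knw N theta (monomial a b) ->
  knw N theta (monomial a' b').
Proof.
move=> lea leb /(knw_translation 1) Wf.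
pose c i j : C := 'C(a, i)%:R * 'C(b, j)%:R; pose D := (maxn a b).+1.
have sumE (e n : nat) (z : C) : (n < e)%N ->
    (z + 1) ^+ n = \sum_(i < e) 'C(n, i)%:R * z ^+ i.
  move=> ne; rewrite addrC exprDn.
  rewrite (big_ord_widen _ (fun i => 1 ^+ (n - i) * z ^+ i *+ 'C(n, i)) ne).
  rewrite big_mkcond; apply: eq_bigr => i _; rewrite expr1n mul1r ltnS.
  by case: leqP => [_|/bin_small->]; rewrite ?mul0r// mulr_natl.
apply: (@knw_monomial_summand _ _ _ D c); rewrite ?ltnS ?leq_max.
- move: Wf; congr knw; apply/funext => z; rewrite /monomial rmorphD rmorph1.
  rewrite (sumE D) ?ltnS ?leq_maxl// (sumE D) ?ltnS ?leq_maxr// big_distrlr /=.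
  by apply: eq_bigr => i _; apply: eq_bigr => j _; rewrite mulrACA.
- by rewrite lea.
- by rewrite leb orbT.
- by rewrite mulf_neq0 ?pnatr_eq0 -?lt0n ?bin_gt0.
Qed.

(** Evaluate the equation at x = 0 and y = 1: all N terms of the sum are 1,
    whereas the monomial vanishes at 0. *)
Lemma knw_invariant_monomialF (C : numClosedFieldType) (N : nat) (theta : C)
    (a b : nat) :
  (0 < N)%N -> (0 < a + b)%N -> monomial a b theta = 1 ->
  ~ knw N theta (monomial a b).
Proof.
move=> N0 ab0 m1 /(_ 0 1)/eqP.
have m0 : monomial a b (0 : C) = 0.
  by rewrite /monomial rmorph0 -exprD expr0n eqn0Ngt ab0.
rewrite m0 mulr0 (eq_bigr (fun=> 1)) => [|k _].
  by rewrite sumr_const card_ord pnatr_eq0 eqn0Ngt N0.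
rewrite add0r mulr1 /monomial rmorphXn -!exprM ![(k * _)%N]mulnC !exprM.
by rewrite -exprMn [_ * _]m1 expr1n.
Qed.

(** By [knw_monomial_le], an exponent at least N would put the N-th power of z or
    of its conjugate in the space, and two positive exponents would put
    [z * z^*] there; all three are invariant under theta. *)
Lemma knw_monomialP (C : numClosedFieldType) (N : nat) (theta : C)
    (a b : nat) :
  N.-primitive_root theta -> knw N theta (monomial a b) ->
  (b = 0%N /\ (a < N)%N) \/ (a = 0%N /\ (b < N)%N).
Proof.
move=> tp Wab; have N0 := prim_order_gt0 tp.
have aN : (a < N)%N.
  rewrite ltnNge; apply/negP => leNa.
  apply: (@knw_invariant_monomialF _ N theta N 0) => //; first by rewrite addn0.
    by rewrite /monomial (prim_expr_order tp) mulr1.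
  exact: knw_monomial_le Wab.
have bN : (b < N)%N.
  rewrite ltnNge; apply/negP => leNb.
  apply: (@knw_invariant_monomialF _ N theta 0 N) => //.
    by rewrite /monomial -rmorphXn (prim_expr_order tp) rmorph1 mulr1.
  exact: knw_monomial_le Wab.
have [->|b0] := posnP b; first by left.
have [->|a0] := posnP a; first by right.
exfalso; apply: (@knw_invariant_monomialF _ N theta 1 1) => //.
  by rewrite /monomial !expr1 -normCK (norm_primitive_root tp) expr1n.
exact: knw_monomial_le Wab.
Qed.

(** * Powers that solve the equation *)

(** A geometric sum of ratio [theta ^+ j], different from 1, over a full
    period. *)
Lemma sum_primitive_root_expr (C : fieldType) (N j : nat) (theta : C) :
  N.-primitive_root theta -> (0 < j < N)%N ->
  \sum_(k < N) theta ^+ k ^+ j = 0.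
Proof.
move=> tp /andP[j0 jN].
have tj1 : theta ^+ j - 1 != 0.
  rewrite subr_eq0 -(prim_order_dvd tp); apply: contraL jN => /dvdn_leq.
  by rewrite -leqNgt; apply.
apply: (mulfI tj1); rewrite mulr0.
under eq_bigr do rewrite -exprM mulnC exprM.
by rewrite -subrX1 -exprM mulnC exprM (prim_expr_order tp) expr1n subrr.
Qed.

Lemma knw_exp (C : fieldType) (N m : nat) (theta : C) :
  N.-primitive_root theta -> (m < N)%N -> knw N theta (fun z => z ^+ m).
Proof.
move=> tp mN x y; under eq_bigr do rewrite exprDn.
rewrite exchange_big big_ord_recl /= [X in _ + X]big1 ?addr0.
  under eq_bigr do rewrite subn0 expr0 mulr1.
  by rewrite sumr_const card_ord bin0 mulr_natl.
move=> j _; under eq_bigr do rewrite exprMn mulrA -mulrnAr mulrAC.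
rewrite -big_distrr /= sum_primitive_root_expr // ?mulr0//.
by rewrite /bump /= add1n (leq_trans _ mN)// ltnS ltn_ord.
Qed.

Lemma knw_conj (C : numClosedFieldType) (N : nat) (theta : C) f :
  knw N theta f -> knw N theta (fun z => (f z)^*).
Proof. by move=> Wf x y; rewrite -rmorph_sum Wf rmorphM rmorph_nat. Qed.

(** * Polynomial functions of z and its conjugate *)

(** The outer variable of the bivariate polynomial stands for the conjugate of z
    and the inner one for z. In this form closure under products is immediate,
    because evaluation is a ring morphism. *)
Definition zzbar_poly (C : numClosedFieldType) : set (C -> C) :=
  [set f | exists P : {poly {poly C}}, forall z, f z = P.[(z^*)%:P].[z]].

Lemma zzbar_polyD (C : numClosedFieldType) (f g : C -> C) :
  zzbar_poly f -> zzbar_poly g -> zzbar_poly (fun z => f z + g z).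
Proof. by move=> [P fE] [Q gE]; exists (P + Q) => z; rewrite fE gE !hornerD. Qed.

Lemma zzbar_polyM (C : numClosedFieldType) (f g : C -> C) :
  zzbar_poly f -> zzbar_poly g -> zzbar_poly (fun z => f z * g z).
Proof. by move=> [P fE] [Q gE]; exists (P * Q) => z; rewrite fE gE !hornerM. Qed.

Lemma zzbar_polyC (C : numClosedFieldType) (c : C) : zzbar_poly (fun=> c).
Proof. by exists c%:P%:P => z; rewrite !hornerC. Qed.

Lemma zzbar_poly_id (C : numClosedFieldType) : zzbar_poly (@id C).
Proof. by exists 'X%:P => z; rewrite hornerC hornerX. Qed.

Lemma zzbar_poly_conj (C : numClosedFieldType) : zzbar_poly (@Num.conj C).
Proof. by exists 'X => z; rewrite hornerX hornerC. Qed.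

Lemma zzbar_poly_sum (C : numClosedFieldType) (n : nat) (f : 'I_n -> C -> C) :
  (forall i, zzbar_poly (f i)) -> zzbar_poly (fun z => \sum_i f i z).
Proof.
elim: n f => [|n IHn] f Pf.
  have := zzbar_polyC (0 : C); congr zzbar_poly; apply/funext => z.
  by rewrite big_ord0.
have := zzbar_polyD (Pf ord0) (IHn _ (fun i => Pf (lift ord0 i))).
by congr zzbar_poly; apply/funext => z; rewrite big_ord_recl.
Qed.

Lemma zzbar_poly_horner (C : numClosedFieldType) (p : {poly C}) (f : C -> C) :
  zzbar_poly f -> zzbar_poly (fun z => p.[f z]).
Proof.
move=> Pf; elim/poly_ind: p => [|p c IHp].
  have := zzbar_polyC (0 : C); congr zzbar_poly; apply/funext => z.
  by rewrite horner0.
have := zzbar_polyD (zzbar_polyM IHp Pf) (zzbar_polyC c).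
by congr zzbar_poly; apply/funext => z; rewrite hornerMXaddC.
Qed.

Lemma zzbar_poly_monomials (C : numClosedFieldType) (f : C -> C) :
  zzbar_poly f -> exists (D : nat) (c : nat -> nat -> C),
    f = fun z => \sum_(a < D) \sum_(b < D) c a b * monomial a b z.
Proof.
move=> [P fE].
pose D := maxn (size P) (\max_(b < size P) size (P`_b)%R).
exists D, (fun a b => P`_b`_a); apply/funext => z; rewrite fE.
rewrite (@horner_coef_wide _ D P) ?leq_maxl// horner_sum exchange_big.
apply: eq_bigr => b _; rewrite -rmorphXn hornerM hornerC.
rewrite (@horner_coef_wide _ D P`_b).
  by rewrite mulr_suml; apply: eq_bigr => a _; rewrite /monomial mulrA.
have [ltbP|leP] := ltnP b (size P); last by rewrite nth_default ?size_poly0.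
have := leq_bigmax_cond (F := fun b : 'I_(size P) => size P`_b) (Ordinal ltbP).
by rewrite leq_max => ->; rewrite ?orbT.
Qed.

(** * Continuity and real translations *)

Local Open Scope complex_scope.

Lemma continuous_real_complex (R : realType) :
  continuous (real_complex R : R -> R[i]^o).
Proof.
move=> x; apply/cvgrPdist_lt => e e0.
have [eR ee] : exists eR, e = eR%:C.
  by exists (complex.Re e); rewrite RRe_real// gtr0_real.
rewrite ee ltcR in e0; near=> y.
rewrite ee -rmorphB normc_def /= expr0n addr0 sqrtr_sqr ltcR.
by near: y; apply: cvgr_dist_lt.
Unshelve. all: by end_near. Qed.

Lemma continuous_conj (R : realType) :
  continuous (@Num.conj R[i] : R[i]^o -> R[i]^o).
Proof.
move=> x.
apply/(@cvgrPdist_lt _ R[i]^o _ _ (nbhs_filter (x : R[i]^o))) => e e0.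
have := nbhsx_ballx (x : R[i]^o) e e0; apply: filterS => y.
by rewrite -rmorphB norm_conjC.
Qed.

Lemma continuous_poly_horner (K : numFieldType) (p : {poly K}) :
  continuous (horner p : K^o -> K^o).
Proof.
elim/poly_ind: p => [|p c IHp].
  rewrite (_ : horner 0 = fun=> 0); first exact: cst_continuous.
  by apply/funext => y; rewrite horner0.
rewrite (_ : horner _ = fun y => p.[y] * y + c); last first.
  by apply/funext => y; rewrite hornerMXaddC.
move=> x; apply: (@continuousD K K^o K^o (fun y => p.[y] * y) (fun=> c)).
  by apply: (@continuousM K K^o (horner p) id); [exact: IHp|exact: cvg_id].
exact: cst_continuous.
Qed.

Lemma continuous_fdiff (R : realType) (f : R[i] -> R[i]) (v : R[i]) :
  continuous (f : R[i]^o -> R[i]^o) ->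
  continuous (fdiff v f : R[i]^o -> R[i]^o).
Proof.
move=> fc x.
apply: (@continuousB R[i] R[i]^o R[i]^o (f \o (+%R^~ v)) f); last exact: fc.
apply: (@continuous_comp R[i]^o R[i]^o R[i]^o (+%R^~ v) f); last exact: fc.
apply: (@continuousD R[i] R[i]^o R[i]^o id (fun=> v)); first exact: cvg_id.
exact: cst_continuous.
Qed.

(** The set where g is non-zero is open, and the rationals are dense. *)
Lemma continuous_eq_rat (R : realType) (g : R -> R[i]^o) :
  continuous g -> (forall q : rat, g (ratr q) = 0) -> forall t, g t = 0.
Proof.
move=> gc gq t; apply: contrapT => gt0.
have : open (g @^-1` [set~ 0]).
  apply: open_comp => [? _|]; first exact: gc.
  apply: closed_openC.
  apply: accessible_closed_set1; apply: hausdorff_accessible.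
  exact: norm_hausdorff.
move=> /(dense_rat _)[]; first by exists t.
by move=> r [gr0 [q _ qr]]; apply: gr0; rewrite -qr; exact: gq.
Qed.

(** This is where continuity of f enters: the interpolation formula passes from
    rational to real times. *)
Lemma newton_poly_real (R : realType) (n : nat) (f : R[i] -> R[i]) (v x : R[i]) :
  continuous (f : R[i]^o -> R[i]^o) ->
  (forall v x, iter n (fdiff v) f x = 0) ->
  forall t : R, f (x + t%:C * v) = (newton_poly n f v x).[t%:C].
Proof.
move=> fc Df0 t; apply/eqP; rewrite -subr_eq0; apply/eqP; move: t.
apply: continuous_eq_rat => [t|q].
  pose l t : R[i]^o := x + t%:C * v.
  have lc : continuous l.
    move=> {}t; apply: (@continuousD R[i] R[i]^o R (fun=> x) (fun t => t%:C * v)).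
      exact: cst_continuous.
    apply: (@continuousM R[i] R (real_complex R) (fun=> v)).
      exact: continuous_real_complex.
    exact: cst_continuous.
  apply: (@continuousB R[i] R[i]^o R (f \o l)
            (horner (newton_poly n f v x) \o real_complex R)).
    by apply: continuous_comp; [exact: lc|exact: fc].
  apply: (@continuous_comp R R[i]^o R[i]^o).
    exact: continuous_real_complex.
  exact: continuous_poly_horner.
(* Going back |numq q| steps is enough, since q >= - |numq q|. *)
pose m := `|denq q|%N; pose K := `|numq q|%N.
have m0 : (0 < m)%N by rewrite absz_gt0 denq_neq0.
have [k qE] : exists k : nat, ratr q = k%:R / m%:R - K%:R :> R.
  exists (absz (numq q + (K * m)%N%:Z)%R).
  have m0' : m%:R != 0 :> R by rewrite pnatr_eq0 -lt0n.
  have num0 : 0 <= numq q + (K * m)%N%:Z by rewrite /K; nia.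
  rewrite natr_absz ger0_norm// rmorphD /= mulrDl [(K * m)%N%:~R]natrM mulfK//.
  rewrite addrK -[in LHS](divq_num_den q) fmorph_div /= !ratr_int.
  by rewrite natr_absz gtr0_norm ?denq_gt0.
by rewrite qE rmorphB fmorph_div !rmorph_nat newton_poly_rat ?subrr.
Qed.

(** Newton's formula is used first from the point [i * Im z] in the direction 1,
    then from 0 in the direction i for each coefficient of the first expansion;
    these coefficients are differences of f, hence again continuous solutions.
    The real and imaginary parts are polynomials in z and its conjugate. *)
Lemma knw_zzbar_poly (R : realType) (N : nat) (theta : R[i])
    (f : R[i] -> R[i]) :
  (0 < N)%N -> theta != 0 -> continuous (f : R[i]^o -> R[i]^o) ->
  knw N theta f -> zzbar_poly f.
Proof.
move=> N0 theta0 fc Wf.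
pose g j := iter j (fdiff 1) f.
have gW j : continuous (g j : R[i]^o -> R[i]^o) /\ knw N theta (g j).
  elim: j => // j [gc gW]; split; first exact: continuous_fdiff.
  exact: knw_fdiff.
have gE j (w : R) : g j (w%:C * 'i) = (newton_poly N (g j) 'i 0).[w%:C].
  rewrite -[in LHS](add0r (_ * _)) (newton_poly_real (n := N) _ _ (gW j).1)//.
  exact: (knw_iter_fdiff_eq0 N0 theta0 (gW j).2).
pose re (z : R[i]) := (z + z^*) * 2^-1.
pose im (z : R[i]) := (z - z^*) * (2 * 'i)^-1.
have reP : zzbar_poly re.
  apply: zzbar_polyM (zzbar_polyC _).
  by apply: zzbar_polyD; [exact: zzbar_poly_id|exact: zzbar_poly_conj].
have imP : zzbar_poly im.
  apply: zzbar_polyM (zzbar_polyC _); apply: zzbar_polyD; first exact: zzbar_poly_id.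
  have := zzbar_polyM (zzbar_polyC (-1)) (@zzbar_poly_conj R[i]).
  by congr zzbar_poly; apply/funext => z; rewrite mulN1r.
suff -> : f = fun z => \sum_(j < N) (newton_poly N (g j) 'i 0).[im z] *
                                   (binomial_poly _ j).[re z].
  by apply: zzbar_poly_sum => j; apply: zzbar_polyM; exact: zzbar_poly_horner.
apply/funext => z.
have reE : re z = (complex.Re z)%:C by rewrite ReJ_add.
have imE : im z = (complex.Im z)%:C.
  by rewrite ImJ_sub /im invfM complexiE invCi; ring.
have -> : f z = f ((complex.Im z)%:C * 'i + (complex.Re z)%:C * 1).
  by rewrite mulr1 addrC mulrC -complexE.
rewrite (newton_poly_real _ _ fc (knw_iter_fdiff_eq0 N0 theta0 Wf)).
rewrite horner_sum; apply: eq_bigr => j _.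
by rewrite hornerZ reE imE -gE.
Qed.

(** * The space of solutions *)

Definition zzbar_family (R : realType) (N : nat) : set (R[i] -> R[i]) :=
  [set f | exists (a : 'rV[R[i]]_N) (b : 'rV[R[i]]_N.-1), f = poly_z_zbar a b].

Lemma zzbar_familyD (R : realType) (N : nat) (f g : R[i] -> R[i]) :
  zzbar_family N f -> zzbar_family N g -> zzbar_family N (fun z => f z + g z).
Proof.
move=> [a [b ->]] [a' [b' ->]]; exists (a + a'), (b + b'); apply/funext => z.
rewrite /poly_z_zbar addrACA -!big_split /=.
by congr (_ + _); apply: eq_bigr => k _; rewrite mxE mulrDl.
Qed.

Lemma zzbar_family0 (R : realType) (N : nat) :
  zzbar_family N (fun=> 0 : R[i]).
Proof.
exists 0, 0; apply/funext => z.
by rewrite /poly_z_zbar !big1 ?addr0// => k _; rewrite mxE mul0r.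
Qed.

Lemma zzbar_family_sum (R : realType) (N n : nat) (f : 'I_n -> R[i] -> R[i]) :
  (forall i, zzbar_family N (f i)) -> zzbar_family N (fun z => \sum_i f i z).
Proof.
elim: n f => [|n IHn] f Pf.
  have := zzbar_family0 R N; congr zzbar_family; apply/funext => z.
  by rewrite big_ord0.
have := zzbar_familyD (Pf ord0) (IHn _ (fun i => Pf (lift ord0 i))).
by congr zzbar_family; apply/funext => z; rewrite big_ord_recl.
Qed.

Lemma zzbar_family_exp (R : realType) (N k : nat) (c : R[i]) :
  (k < N)%N -> zzbar_family N (fun z => c * z ^+ k).
Proof.
move=> kN; exists (c *: delta_mx 0 (Ordinal kN)), 0; apply/funext => z.
rewrite /poly_z_zbar (bigD1 (Ordinal kN)) //= big1 => [|i ik].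
  rewrite big1 => [|i _]; last by rewrite mxE mul0r.
  by rewrite !mxE !eqxx mulr1 !addr0.
by rewrite !mxE (negPf ik) andbF mulr0 mul0r.
Qed.

Lemma zzbar_family_conj_exp (R : realType) (N k : nat) (c : R[i]) :
  (k.+1 < N)%N -> zzbar_family N (fun z => c * (z^*) ^+ k.+1).
Proof.
move=> kN; have kN1 : (k < N.-1)%N by case: N kN.
exists 0, (c *: delta_mx 0 (Ordinal kN1)); apply/funext => z.
rewrite /poly_z_zbar [X in X + _]big1 => [|i _]; last by rewrite mxE mul0r.
rewrite (bigD1 (Ordinal kN1)) //= big1 => [|i ik].
  by rewrite !mxE !eqxx mulr1 addr0 add0r.
by rewrite !mxE (negPf ik) andbF mulr0 mul0r.
Qed.

(** Each term of the polynomial expansion of f is either zero or a multiple of a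
    monomial that solves the equation, hence of one of the admitted powers. *)
Lemma knw_zzbar_family (R : realType) (N : nat) (theta : R[i]) f :
  N.-primitive_root theta ->
  continuous (f : R[i]^o -> R[i]^o) -> knw N theta f -> zzbar_family N f.
Proof.
move=> tp fc Wf; have N0 := prim_order_gt0 tp.
have theta0 := primitive_root_neq0 tp.
have [D [c fE]] := zzbar_poly_monomials (knw_zzbar_poly N0 theta0 fc Wf).
move: Wf; rewrite fE => Wf.
apply: zzbar_family_sum => a; apply: zzbar_family_sum => b.
have [->|cab] := eqVneq (c a b) 0.
  have := zzbar_family0 R N; congr zzbar_family; apply/funext => z.
  by rewrite mul0r.
have := knw_monomial_summand Wf (ltn_ord a) (ltn_ord b) cab.
rewrite /monomial => /(knw_monomialP tp) [[-> aN]|[-> bN]].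
  have := zzbar_family_exp (c a 0%N) aN; congr zzbar_family; apply/funext => z.
  by rewrite !expr0 !mulr1.
move: bN; case: (nat_of_ord b) => [|k] kN.
  have := zzbar_family_exp (c 0%N 0%N) N0; congr zzbar_family; apply/funext => z.
  by rewrite !expr0 !mulr1.
have := zzbar_family_conj_exp (c 0%N k.+1) kN; congr zzbar_family; apply/funext => z.
by rewrite expr0 mul1r.
Qed.

Lemma knwE (R : realType) (N : nat) (theta : R[i]) f : (0 < N)%N ->
  S_KNW N theta f <->
  continuous (f : R[i]^o -> R[i]^o) /\ knw N theta f.
Proof.
move=> N0; have n0 : N%:R != 0 :> R[i] by rewrite pnatr_eq0 -lt0n.
by split=> -[fc Wf]; split=> // x y; [rewrite -(Wf x y) mulVKf|rewrite Wf mulKf].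
Qed.

Lemma knw_sum (C : fieldType) (N n : nat) (theta : C)
    (c : 'I_n -> C) (f : 'I_n -> C -> C) :
  (forall i, knw N theta (f i)) -> knw N theta (fun z => \sum_i c i * f i z).
Proof.
move=> Wf x y; rewrite exchange_big big_distrr; apply: eq_bigr => i _ /=.
by rewrite -big_distrr /= Wf mulrCA.
Qed.

Lemma zzbar_family_knw (R : realType) (N : nat) (theta : R[i]) f :
  N.-primitive_root theta -> zzbar_family N f ->
  continuous (f : R[i]^o -> R[i]^o) /\ knw N theta f.
Proof.
move=> tp [a [b ->]]; split.
  pose p : {poly R[i]} := \sum_(k < N) a 0 k *: 'X^k.
  pose q : {poly R[i]} := \sum_(k < N.-1) b 0 k *: 'X^(k.+1).
  rewrite (_ : poly_z_zbar a b = fun z => p.[z] + q.[z^*]); last first.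
    apply/funext => z; rewrite !horner_sum.
    by congr (_ + _); apply: eq_bigr => k _; rewrite hornerZ hornerXn.
  move=> x; apply: (@continuousD R[i] R[i]^o R[i]^o (horner p)
                      (horner q \o @Num.conj R[i])).
    exact: continuous_poly_horner.
  apply: (@continuous_comp R[i]^o R[i]^o R[i]^o).
    exact: continuous_conj.
  exact: continuous_poly_horner.
have [WD _] := knw_dilation_subspace N theta.
have Wa : knw N theta (fun z => \sum_(k < N) a 0 k * z ^+ k).
  by apply: knw_sum => k; exact: knw_exp.
have Wb : knw N theta (fun z => \sum_(k < N.-1) b 0 k * (z^*) ^+ k.+1).
  apply: knw_sum => k; have kN : (k.+1 < N)%N by rewrite -ltn_predRL.
  have := knw_conj (knw_exp tp kN); congr knw; apply/funext => z.
  by rewrite rmorphXn.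
have := WD 1 _ _ Wa Wb; congr knw; apply/funext => z.
by rewrite mul1r.
Qed.

Theorem theorem2p4 (R : realType) (N : nat) (theta : R[i]) :
  (1 <= N)%N -> N.-primitive_root theta ->
  S_KNW N theta =
  [set f | exists (a : 'rV[R[i]]_N) (b : 'rV[R[i]]_N.-1),
             f = poly_z_zbar a b].
Proof.
move=> N0 tp; apply/seteqP; split=> f.
  by move=> /(knwE _ _ N0)[fc Wf]; exact: knw_zzbar_family Wf.
by move=> /(zzbar_family_knw tp) ?; apply/(knwE _ _ N0).
Qed.
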